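(* For all integers $m$ and $n\ge1$: $N_{\overline{S}}(m,n)$ equals the number of $\vec\lambda\in\overline{SP}$ with $|\vec\lambda|=n$ and $\overline{\mathrm{crank}}(\vec\lambda)=m$; $N_{\overline{S}_1}(m,n)$ equals the number of $\vec\lambda\in\overline{SP}_1$ with $|\vec\lambda|=n$ and $\overline{\mathrm{crank}}(\vec\lambda)=m$; $N_{\overline{S}_2}(m,n)$ equals the number of $\vec\lambda\in\overline{SP}_2$ with $|\vec\lambda|=n$ and $\overline{\mathrm{crank}}(\vec\lambda)=m$.
   Context: $(a;q)_\infty=\prod_{k\ge0}(1-aq^k)$. The coefficients $N_{\overline{S}}(m,n)$, $N_{\overline{S}_1}(m,n)$, $N_{\overline{S}_2}(m,n)$ are defined by \begin{align*} \sum_{n,m}N_{\overline{S}}(m,n)z^mq^n&=\sum_{n=1}^\infty\frac{q^n(-q^{n+1};q)_\infty(q^{n+1};q)_\infty}{(zq^n;q)_\infty(z^{-1}q^n;q)_\infty},\\ \sum_{n,m}N_{\overline{S}_1}(m,n)z^mq^n&=\sum_{n=0}^\infty\frac{q^{2n+1}(-q^{2n+2};q)_\infty(q^{2n+2};q)_\infty}{(zq^{2n+1};q)_\infty(z^{-1}q^{2n+1};q)_\infty},\\ \sum_{n,m}N_{\overline{S}_2}(m,n)z^mq^n&=\sum_{n=1}^\infty\frac{q^{2n}(-q^{2n+1};q)_\infty(q^{2n+1};q)_\infty}{(zq^{2n};q)_\infty(z^{-1}q^{2n};q)_\infty}. \end{align*} For a partition $\lambda$, $s(\lambda)$ is its smallest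 part ($s(\emptyset)=\infty$) and $|\lambda|$ its sum. $\overline{SP}$ is the set of pairs $\vec\lambda=(\lambda_1,\lambda_2)$ of partitions with $0<s(\lambda_1)\le s(\lambda_2)$ (so $\lambda_1$ is nonempty) such that every part of $\lambda_2$ that is $\ge 2s(\lambda_1)+1$ is odd; $|\vec\lambda|=|\lambda_1|+|\lambda_2|$. $\overline{SP}_1$ (resp. $\overline{SP}_2$) is the subset with $s(\lambda_1)$ odd (resp. even). For $\vec\lambda\in\overline{SP}$, let $k=k(\vec\lambda)$ be the number of parts $j$ of $\lambda_2$ (counted with multiplicity) with $s(\lambda_1)\le j\le 2s(\lambda_1)-1$, and define $\overline{\mathrm{crank}}(\vec\lambda)$ to be (number of parts of $\lambda_1$ that are $\ge s(\lambda_1)+k$) $-\,k$ if $k>0$, and (number of parts of $\lambda_1$) $-1$ if $k=0$. *)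

(* Defs.v *)
From mathcomp Require Import all_boot all_order all_algebra.
Set Implicit Arguments. Unset Strict Implicit. Unset Printing Implicit Defensive.
Import Order.TTheory GRing.Theory Num.Theory.
Local Open Scope ring_scope.

(* Formal series  F = sum_{n >= 0, m in Z} F n m  z^m q^n  with integer     *)
(* coefficients.  All series occurring in the generating functions lie in   *)
(* the ring of "admissible" series, i.e. those with F n m = 0 unless        *)
(* |m| <= n (every z^{+-1} comes with at least one q).  On this ring the    *)
(* product below is exactly the Cauchy product in q and the convolution in z *)
(* (the window conditions only drop coefficients outside the admissible     *)
(* support, so the sums are finite).                                        *)
Definition ser := nat -> int -> int.

Definition smono (c : int) (e : int) (d : nat) : ser :=
  fun n m => if (n == d) && (m == e) then c else 0.

Definition szero : ser := fun _ _ => 0.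
Definition sone : ser := smono 1 0 0.
Definition sadd (F G : ser) : ser := fun n m => F n m + G n m.
Definition ssub (F G : ser) : ser := fun n m => F n m - G n m.

Definition smul (F G : ser) : ser := fun n m =>
  \sum_(i < n.+1) \sum_(t < (2 * i).+1)
     let j := (t%:Z - i%:Z) in
     if (absz (m - j) <= n - i)%N then F i j * G (n - i)%N (m - j) else 0.

Definition sprodl (f : nat -> ser) (K : nat) : ser :=
  foldr (fun k acc => smul (f k) acc) sone (iota 0 K).
Definition ssuml (f : nat -> ser) (K : nat) : ser :=
  foldr (fun k acc => sadd (f k) acc) szero (iota 0 K).

Definition sconv (F : nat -> ser) (G : ser) : Prop :=
  forall n m, exists K, forall k, (K <= k)%N -> F k n m = G n m.

Definition poch_inf (c : int) (e : int) (d : nat) (P : ser) : Prop :=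
  sconv (sprodl (fun k => ssub sone (smono c e (d + k)))) P.

Definition gen_series (ex : nat -> nat) (G : ser) : Prop :=
  exists (Pm Pp Pz Pzi Inv : nat -> ser),
    (forall j, poch_inf (-1) 0 (ex j).+1 (Pm j)) /\
    (forall j, poch_inf 1 0 (ex j).+1 (Pp j)) /\
    (forall j, poch_inf 1 1 (ex j) (Pz j)) /\
    (forall j, poch_inf 1 (-1) (ex j) (Pzi j)) /\
    (forall j, smul (smul (Pz j) (Pzi j)) (Inv j) = sone) /\
    sconv (ssuml (fun j => smul (smono 1 0 (ex j))
                                 (smul (smul (Pm j) (Pp j)) (Inv j)))) G.

Definition ex_S  (j : nat) : nat := j.+1.
Definition ex_S1 (j : nat) : nat := (2 * j).+1.
Definition ex_S2 (j : nat) : nat := (2 * j).+2.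

Definition is_partition (l : seq nat) : bool :=
  sorted geq l && all (fun x => 0 < x)%N l.

Definition spart (l : seq nat) : nat := foldr minn (head 0%N l) l.

Definition in_SPbar (p : seq nat * seq nat) : bool :=
  let: (l1, l2) := p in
  let s := spart l1 in
  [&& is_partition l1, is_partition l2, l1 != [::],
      all (fun j => s <= j)%N l2 &
      all (fun j => (2 * s + 1 <= j)%N ==> odd j) l2].

Definition SPweight (p : seq nat * seq nat) : nat := (sumn p.1 + sumn p.2)%N.

Definition kSP (p : seq nat * seq nat) : nat :=
  let s := spart p.1 in count (fun j => (s <= j) && (j <= 2 * s - 1))%N p.2.

Definition crank_bar (p : seq nat * seq nat) : int :=
  let s := spart p.1 in
  let k := kSP p in
  if (0 < k)%N then (count (fun j => s + k <= j)%N p.1)%:Z - k%:Z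
  else (size p.1)%:Z - 1.

Definition counts (P : seq nat * seq nat -> Prop) (N : nat) : Prop :=
  exists L : seq (seq nat * seq nat),
    uniq L /\ (forall x, x \in L <-> P x) /\ size L = N.

(* Main.v *)
(* Fix the smallest part s of lambda_1 and put a = z q^s, b = z^-1 q^s, so that
   ab = q^(2s). If k parts of lambda_2 lie in [s, 2s - 1], they contribute
   b^k (q^s;q)_k / (q;q)_k, while the parts of lambda_1 other than one copy of s
   contribute 1 / ((q^s;q)_k (a q^k;q)_oo). After cancelling (q^s;q)_k, the sum
   over k is evaluated by the q-binomial theorem
   sum_k (a;q)_k / (q;q)_k b^k = (ab;q)_oo / (b;q)_oo. The remaining parts of
   lambda_2 contribute 1 / ((1 - q^(2s)) (q^(2s+1);q^2)_oo), which turns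
   (q^(2s);q)_oo into (q^(2s+2);q^2)_oo = (-q^(s+1);q)_oo (q^(s+1);q)_oo.

   Coefficients of q^i for i <= n are compared in the ring of series modulo
   q^(n+1), where q, a, b are nilpotent: there every infinite product is finite
   and 1 / (1 - x) is the geometric sum of the powers of x. *)
From HB Require Import structures.
Require Import Defs.
From Stdlib Require Import FunctionalExtensionality ClassicalEpsilon.
From mathcomp Require Import all_boot all_order all_algebra.
From mathcomp Require Import zify ring.
Set Implicit Arguments. Unset Strict Implicit. Unset Printing Implicit Defensive.
Import Order.TTheory GRing.Theory Num.Theory.
Local Open Scope ring_scope.

(** * q-series with nilpotent variables *)

Definition geo (R : nzRingType) (M : nat) (x : R) : R := \sum_(i < M) x ^+ i.

Definition qpoch (R : nzRingType) (q a : R) (k : nat) : R :=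
  \prod_(i < k) (1 - a * q ^+ i).

Section NilpotentQSeries.
Variables (R : comNzRingType) (M : nat).
Implicit Types (x y q a b : R) (F : nat -> R).

Lemma geoK x : x ^+ M = 0 -> (1 - x) * geo M x = 1.
Proof. by move=> x0; rewrite -opprB mulNr -subrX1 x0 sub0r opprK. Qed.

Lemma geo0 : (0 < M)%N -> geo M (0 : R) = 1.
Proof.
rewrite /geo; case: M => // M' _; rewrite big_ord_recl expr0 big1 ?addr0 // => i _.
by rewrite lift0 exprS mul0r.
Qed.

Lemma nilMl x y : x ^+ M = 0 -> (x * y) ^+ M = 0.
Proof. by move=> x0; rewrite exprMn x0 mul0r. Qed.

Lemma expr_ge0 x n : x ^+ M = 0 -> (M <= n)%N -> x ^+ n = 0.
Proof. by move=> x0 /subnK <-; rewrite exprD x0 mulr0. Qed.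

Lemma nil_exp x n : x ^+ M = 0 -> (0 < n)%N -> (x ^+ n) ^+ M = 0.
Proof. by move=> x0 n0; rewrite -exprM (expr_ge0 x0) // leq_pmull. Qed.

Lemma geo_prodK F k : (forall i, F i ^+ M = 0) ->
  \prod_(i < k) (1 - F i) * \prod_(i < k) geo M (F i) = 1.
Proof. by move=> F0; rewrite -big_split big1 // => i _; apply: geoK. Qed.

(** Infinite products are represented by their first [M] factors; any longer range may be
    substituted when an index shift or a parity split asks for it. *)
Lemma big_ord_stable (F : nat -> R) k :
  (forall i, (M <= i)%N -> F i = 1) -> (M <= k)%N ->
  \prod_(i < k) F i = \prod_(i < M) F i.
Proof.
move=> F1 Mk; rewrite -!(big_mkord xpredT F) (big_cat_nat (leq0n M) Mk) //=.
rewrite [X in _ * X]big_nat_cond [X in _ * X]big1 ?mulr1 // => i.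
by rewrite andbT => /andP[/F1].
Qed.

Section Nome.
Variable q : R.
Hypothesis qM : q ^+ M = 0.

Lemma qpoch_stable a k : (M <= k)%N -> qpoch q a k = qpoch q a M.
Proof.
move=> Mk; apply: (big_ord_stable (F := fun i => 1 - a * q ^+ i)) => // i Mi.
by rewrite (expr_ge0 qM Mi) mulr0 subr0.
Qed.

Lemma qpochS a k : qpoch q a k.+1 = qpoch q a k * (1 - a * q ^+ k).
Proof. by rewrite /qpoch big_ord_recr. Qed.

Lemma qpochSl a k : qpoch q a k.+1 = (1 - a) * qpoch q (a * q) k.
Proof.
rewrite /qpoch big_ord_recl expr0 mulr1; congr (_ * _).
by apply: eq_bigr => i _; rewrite lift0 exprS mulrA.
Qed.

(** This is (a;q)_k / (q;q)_k, each 1 / (1 - q^i) being written as a geometric sum. *)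
Definition qbin_coef a k := qpoch q a k * \prod_(i < k) geo M (q ^+ i.+1).

Lemma qbin_coefS a k :
  qbin_coef a k.+1 * (1 - q ^+ k.+1) = qbin_coef a k * (1 - a * q ^+ k).
Proof.
rewrite /qbin_coef qpochS big_ord_recr /=.
have := geoK (nil_exp qM (ltn0Sn k)); move: (\prod_(i < k) _) (geo _ _) => p g H.
transitivity (qpoch q a k * p * (1 - a * q ^+ k) * ((1 - q ^+ k.+1) * g)).
  by ring.
by rewrite H mulr1.
Qed.

(** The functional equation F(b) (1 - b) = (1 - a b) F(b q) of the q-binomial series. It stays exact
    after cutting the series at [K] because b^K = 0. *)
Lemma qbinomial_step a b K : b ^+ K = 0 ->
  (\sum_(k < K) qbin_coef a k * b ^+ k) * (1 - b) =
  (1 - a * b) * \sum_(k < K) qbin_coef a k * (b * q) ^+ k.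
Proof.
move=> bK; apply/eqP; rewrite -subr_eq0; apply/eqP.
set F := \sum_(k < K) _ * _; set G := \sum_(k < K) _.
suff: F - G = b * F - a * b * G.
  by move=> /eqP; rewrite -subr_eq0 => /eqP H; rewrite -H; ring.
have -> : F - G = \sum_(k < K) qbin_coef a k * (1 - q ^+ k) * b ^+ k.
  by rewrite -sumrB; apply: eq_bigr => k _; rewrite exprMn; ring.
have -> : b * F - a * b * G =
    \sum_(k < K) qbin_coef a k * (1 - a * q ^+ k) * b ^+ k.+1.
  rewrite !mulr_sumr -sumrB; apply: eq_bigr => k _; rewrite exprMn exprS; ring.
(* Align the indices: the k = 0 term on the left contains 1 - q^0 = 0, and the last term on the
   right contains the vanishing power of b. *)
case: K bK {F G} => [|K] bK; first by rewrite !big_ord0.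
rewrite big_ord_recl expr0 subrr mulr0 mul0r add0r.
rewrite big_ord_recr /= bK mulr0 addr0.
by apply: eq_bigr => k _; rewrite /bump add1n qbin_coefS.
Qed.

(** Iterating the functional equation [M] times replaces b by b q^M = 0, and the series collapses to
    its term k = 0, which is 1. *)
Lemma qbinomial a b K : b ^+ M = 0 -> (M <= K)%N -> (0 < K)%N ->
  (\sum_(k < K) qbin_coef a k * b ^+ k) * qpoch q b M = qpoch q (a * b) M.
Proof.
move=> bM MK K0.
have bK: b ^+ K = 0 by apply: expr_ge0 bM MK.
have iterE n : (\sum_(k < K) qbin_coef a k * b ^+ k) * qpoch q b n =
    qpoch q (a * b) n * \sum_(k < K) qbin_coef a k * (b * q ^+ n) ^+ k.
  elim: n => [|n IHn].
    by rewrite /qpoch !big_ord0 mul1r mulr1 expr0 mulr1.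
  rewrite !qpochS mulrA IHn -!mulrA qbinomial_step; last first.
    by rewrite exprMn bK mul0r.
  by rewrite exprSr !mulrA.
rewrite iterE qM mulr0; case: K K0 {MK bK iterE} => // K _.
rewrite big_ord_recl big1 ?addr0 => [|i _].
  by rewrite /qbin_coef /qpoch !big_ord0 !mulr1.
by rewrite lift0 exprS mul0r mulr0.
Qed.

(* Coefficient of [t^k] in [\prod_(i < n) 1 / (1 - b q^i t)], by the recurrence
   of the complete homogeneous symmetric functions. *)
Lemma coef_prod_geo b n k : b ^+ M = 0 ->
  (\prod_(i < n) geo M ((b * q ^+ i) *: 'X))`_k * qpoch q q k =
  b ^+ k * qpoch q (q ^+ n) k.
Proof.
move=> bM; set P := fun n => \prod_(i < n) geo M ((b * q ^+ i) *: 'X).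
have PS m : P m.+1 * (1 - (b * q ^+ m) *: 'X) = P m.
  rewrite /P big_ord_recr /= -mulrA [geo _ _ * _]mulrC; set x := _ *: 'X.
  have x0 : x ^+ M = 0 by rewrite exprZn exprMn bM mul0r scale0r.
  by rewrite -opprB mulNr -subrX1 x0 sub0r opprK mulr1.
have P0S m : (P m.+1)`_0 = (P m)`_0.
  by rewrite -[in RHS]PS mulrBr mulr1 -scalerAr coefB coefZ coefMX mulr0 subr0.
have PSS m j : (P m.+1)`_j.+1 = (P m)`_j.+1 + b * q ^+ m * (P m.+1)`_j.
  by rewrite -[in RHS]PS mulrBr mulr1 -scalerAr coefB coefZ coefMX /= subrK.
(* Double induction: [PSS] expresses the coefficient at (n+1, k+1) through those at (n, k+1) and
   (n+1, k). At n = 0 the factor 1 - q^0 makes the right side vanish. *)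
rewrite -/(P n); elim: k n => [|k IHk] n.
  rewrite /qpoch !big_ord0 !mulr1.
  by elim: n => [|n IHn]; rewrite ?P0S // /P big_ord0 coef1.
elim: n => [|n IHn].
  by rewrite {1}/P big_ord0 coef1 mul0r qpochSl expr0 subrr mul0r mulr0.
rewrite PSS mulrDl IHn [qpoch q q k.+1]qpochS -mulrA.
have -> : b * (q ^+ n * (P n.+1)`_k) * (qpoch q q k * (1 - q * q ^+ k)) =
   b * q ^+ n * (1 - q * q ^+ k) * ((P n.+1)`_k * qpoch q q k) by ring.
rewrite IHk qpochSl qpochS -exprSr -!exprS exprS -exprD addSn.
move: (qpoch _ _ _) => w; rewrite -addnS exprD !exprS; ring.
Qed.
End Nome.
End NilpotentQSeries.

(** * The summand attached to one smallest part *)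

Section SmallestPartSummand.
Variables (R : comNzRingType) (M s K : nat) (q a b : R).
Hypotheses (qM : q ^+ M = 0) (aM : a ^+ M = 0) (bM : b ^+ M = 0).
Hypotheses (abE : a * b = q ^+ (2 * s)) (s_gt0 : (0 < s)%N).
Hypotheses (MK : (M <= K)%N) (K_gt0 : (0 < K)%N).

Lemma qpoch_split_parity x m :
  qpoch q x (2 * m).+1 =
  (1 - x) * \prod_(i < m) (1 - x * q ^+ (2 * i).+1)
          * \prod_(i < m) (1 - x * q ^+ (2 * i).+2).
Proof.
elim: m => [|m IHm]; first by rewrite /qpoch big_ord_recl !big_ord0 expr0; ring.
by rewrite mulnS !qpochS -/(2 * m).+1 -qpochS IHm !big_ord_recr /=; ring.
Qed.

(** In (q^(2s);q)_oo the factors with exponent 2s or 2s plus an odd number cancel; the others are 1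
    - q^(2j) = (1 + q^j)(1 - q^j) with j > s. *)
Lemma odd_parts_cancel :
  qpoch q (q ^+ (2 * s)) M *
    (geo M (q ^+ (2 * s)) * \prod_(i < M) geo M (q ^+ (2 * s + (2 * i).+1))) =
  \prod_(i < M) ((1 + q ^+ (s.+1 + i)) * (1 - q ^+ (s.+1 + i))).
Proof.
(* With [(2 * M).+1] factors, the parity split gives the first factor and two products of exactly
   [M] factors. *)
have MM : (M <= (2 * M).+1)%N by lia.
rewrite -(qpoch_stable qM _ MM) qpoch_split_parity.
under [X in _ * X * _]eq_bigr => i _ do rewrite -exprD.
have s2 : (0 < 2 * s)%N by lia.
have G1 := geoK (nil_exp qM s2).
have G2 := @geo_prodK _ M (fun i => q ^+ (2 * s + (2 * i).+1)) M
  (fun i => nil_exp qM (ltn_addr _ s2)).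
have -> : \prod_(i < M) ((1 + q ^+ (s.+1 + i)) * (1 - q ^+ (s.+1 + i))) =
          \prod_(i < M) (1 - q ^+ (2 * s) * q ^+ (2 * i).+2).
  apply: eq_bigr => i _; rewrite -exprD.
  have -> : (2 * s + (2 * i).+2 = (s.+1 + i) + (s.+1 + i))%N by lia.
  by move: (s.+1 + i)%N => j; rewrite exprD; ring.
move: G1 G2; move: (geo _ _) (\prod_(i < M) (1 - q ^+ (2 * s + _))).
move: (\prod_(i < M) geo _ _) (\prod_(i < M) (1 - _)) => w x y z G1 G2.
transitivity ((1 - q ^+ (2 * s)) * y * (z * w) * x); first by ring.
by rewrite G1 G2 !mul1r.
Qed.

Lemma summand_identity :
  (\sum_(k < K) (\prod_(i < s) geo M ((b * q ^+ i) *: 'X))`_k *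
     (\prod_(i < k) geo M (q ^+ (s + i)) * \prod_(i < M) geo M (a * q ^+ (k + i))))
  * (geo M (q ^+ (2 * s)) * \prod_(i < M) geo M (q ^+ (2 * s + (2 * i).+1))) =
  \prod_(i < M) ((1 + q ^+ (s.+1 + i)) * (1 - q ^+ (s.+1 + i))) *
    (\prod_(i < M) geo M (a * q ^+ i) * \prod_(i < M) geo M (b * q ^+ i)).
Proof.
have Ga := @geo_prodK _ M (fun i => a * q ^+ i) M (fun i => nilMl _ aM).
have Gb := @geo_prodK _ M (fun i => b * q ^+ i) M (fun i => nilMl _ bM).
rewrite -odd_parts_cancel -abE -(qbinomial qM a bM MK K_gt0).
set S := \sum_(k < K) _ * (_ * _); set D := geo M _ * _.
set Pa := \prod_(i < M) geo M _ in Ga *; set Pb := \prod_(i < M) geo M _ in Gb *.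
(* The q-binomial theorem, read backwards, has turned (ab;q)_oo into a sum over k times (b;q)_oo,
   which cancels [Pb]. What remains holds term by term in k. *)
suff -> : S = Pa * \sum_(k < K) qbin_coef M q a k * b ^+ k.
  move: (\sum_(k < K) _) => F.
  transitivity (Pa * F * D * (qpoch q b M * Pb)); first by rewrite Gb mulr1.
  by ring.
rewrite mulr_sumr; apply: eq_bigr => k _.
have Gs := @geo_prodK _ M (fun i => q ^+ (s + i)) k
  (fun i => nil_exp qM (ltn_addr _ s_gt0)).
have Gq := @geo_prodK _ M (fun i => q ^+ i.+1) k
  (fun i => nil_exp qM (ltn0Sn i)).
have Gk := @geo_prodK _ M (fun i => a * q ^+ (k + i)) M (fun i => nilMl _ aM).
have H := coef_prod_geo q s k bM.
have E1 : qpoch q (q ^+ s) k = \prod_(i < k) (1 - q ^+ (s + i)).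
  by apply: eq_bigr => i _; rewrite exprD.
have E2 : qpoch q q k = \prod_(i < k) (1 - q ^+ i.+1).
  by apply: eq_bigr => i _; rewrite exprS.
have E3 : qpoch q a M = qpoch q a k * \prod_(i < M) (1 - a * q ^+ (k + i)).
  by rewrite -(qpoch_stable qM a (leq_addl k M)) /qpoch big_split_ord.
rewrite -E1 in Gs; rewrite -E2 in Gq; rewrite -/(qpoch q a M) E3 in Ga.
rewrite /qbin_coef.
move: Ga Gs Gq Gk H; rewrite -/Pa.
move: (_`_k) (\prod_(i < k) geo M (q ^+ (s + i))) (\prod_(i < M) geo M _).
move: (\prod_(i < k) geo M _) (\prod_(i < M) (1 - _)).
move: (qpoch q (q ^+ s) k) (qpoch q q k) (qpoch q a k) => x1 x2 x3 x4 x5 x6 x7 x8.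
move=> Ga Gs Gq Gk H.
(* Here [x1], [x2], [x3] are (q^s;q)_k, (q;q)_k, (a;q)_k and [x6] is the coefficient of 'X^k.
   Inserting x2 x4 = 1 and x3 x5 Pa = 1 lets [H] trade x6 x2 for b^k x1; then x1 x7 = 1 and x5 x8 =
   1 cancel. *)
transitivity (x6 * x2 * x4 * (x3 * x5 * Pa) * (x7 * x8)).
  by rewrite Ga -[x6 * x2 * x4]mulrA Gq !mulr1.
rewrite H.
transitivity (b ^+ k * x4 * x3 * Pa * (x1 * x7) * (x5 * x8)); first by ring.
by rewrite Gs Gk; ring.
Qed.
End SmallestPartSummand.

(** * Truncation of formal series *)

(* Truncated series mod [q^(n+1)]; [z^m q^d] is encoded as ['X^(m + d)] times
   the [d]-th power of the outer variable, so that exponents stay natural. *)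
Definition tser n := {poly %/ ('X^(n.+1) : {poly {poly int}})}.
HB.instance Definition _ n := GRing.ComNzRing.on (tser n).

Definition zrow (F : ser) (i : nat) : {poly int} :=
  \poly_(t < (2 * i).+1) F i (t%:Z - i%:Z).

Definition qtrunc n (F : ser) : tser n :=
  in_qpoly 'X^(n.+1) (\poly_(i < n.+1) zrow F i).

Definition mono n (t d : nat) : tser n := in_qpoly 'X^(n.+1) ('X^t *: 'X^d).

Definition tcoef n (x : tser n) i : {poly int} := (x : {poly {poly int}})`_i.

Definition admissible (F : ser) := forall n m, (n < absz m)%N -> F n m = 0.

Section Truncation.
Variable n : nat.
Implicit Types (x y : tser n) (F G : ser).

Lemma tcoef_in (p : {poly {poly int}}) i : (i <= n)%N ->
  tcoef (in_qpoly 'X^(n.+1) p : tser n) i = p`_i.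
Proof.
move=> ilen; rewrite /tcoef /= mk_monic_Xn /= -Pdiv.RingMonic.take_poly_rmodp.
by rewrite coef_take_poly ltnS ilen.
Qed.

Lemma tser_ext x y : (forall i, (i <= n)%N -> tcoef x i = tcoef y i) -> x = y.
Proof.
move=> H; apply: val_inj; apply/polyP => i /=.
have [|ni] := leqP i n; first exact: H.
have small (w : tser n) : (size (w : {poly {poly int}}) <= i)%N.
  apply: leq_trans ni; rewrite -ltnS (leq_trans (size_mk_monic w)) //.
  by rewrite mk_monic_Xn size_polyXn.
by rewrite !nth_default ?small.
Qed.

Lemma tcoefM x y i : (i <= n)%N ->
  tcoef (x * y) i = \sum_(j < i.+1) tcoef x j * tcoef y (i - j).
Proof. by move=> ilen; rewrite [x * y]/(in_qpoly _ _) tcoef_in // coefM. Qed.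

Lemma tcoef_sum (I : finType) (P : pred I) (f : I -> tser n) i :
  tcoef (\sum_(j | P j) f j) i = \sum_(j | P j) tcoef (f j) i.
Proof. by rewrite /tcoef poly_of_qpoly_sum coef_sum. Qed.

Lemma tcoef_qtrunc F i : (i <= n)%N -> tcoef (qtrunc n F) i = zrow F i.
Proof. by move=> ilen; rewrite tcoef_in // coef_poly ltnS ilen. Qed.

Lemma tcoef_mono t d i : (i <= n)%N ->
  tcoef (mono n t d) i = if i == d then 'X^t else 0.
Proof.
move=> ilen; rewrite tcoef_in // coefZ coefXn.
by case: eqP => _; rewrite ?mulr1 ?mulr0.
Qed.

Lemma eq_qtrunc F G : (forall i, (i <= n)%N -> zrow F i = zrow G i) ->
  qtrunc n F = qtrunc n G.
Proof. by move=> H; apply: tser_ext => i ilen; rewrite !tcoef_qtrunc ?H. Qed.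

Lemma qtrunc_zrow F G i : qtrunc n F = qtrunc n G -> (i <= n)%N -> zrow F i = zrow G i.
Proof. by move=> H ilen; rewrite -!(tcoef_qtrunc _ ilen) H. Qed.

Lemma coef_zrow F i (t : nat) : (t <= 2 * i)%N -> (zrow F i)`_t = F i (t%:Z - i%:Z).
Proof. by move=> ti; rewrite coef_poly ltnS ti. Qed.

Lemma zrow_coef F i (m : int) : (absz m <= i)%N -> F i m = (zrow F i)`_(absz (m + i%:Z)).
Proof. by move=> mi; rewrite coef_zrow; first congr (F i _); lia. Qed.

Lemma sum_ord_support (h : nat -> int) a b :
  (forall i, (a <= i)%N -> h i = 0) -> (forall i, (b <= i)%N -> h i = 0) ->
  \sum_(i < a) h i = \sum_(i < b) h i.
Proof.
move=> ha hb.
have ext c d : (forall i, (c <= i)%N -> h i = 0) -> \sum_(i < c) h i = \sum_(i < c + d) h i.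
  by move=> hc; rewrite big_split_ord /= [X in _ = _ + X]big1 ?addr0 // => i _; apply/hc/leq_addr.
by rewrite (ext a b ha) addnC (ext b a hb).
Qed.

(** In shifted exponents the windows of [smul] become 0 <= t' <= 2j and 0 <= t - t' <= 2(i - j), the
    ranges of the two rows, so [smul] is polynomial multiplication. *)
Lemma qtrunc_mul F G : qtrunc n (smul F G) = qtrunc n F * qtrunc n G.
Proof.
apply: tser_ext => i ilen; rewrite tcoefM // tcoef_qtrunc //.
apply/polyP => t; rewrite coef_poly coef_sum.
transitivity (\sum_(j < i.+1) \sum_(t' < t.+1)
   if [&& t' <= 2 * j & t - t' <= 2 * (i - j)]%N
   then F j (t'%:Z - j%:Z) * G (i - j)%N ((t - t')%N%:Z - (i - j)%N%:Z) else 0); last first.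
  apply: eq_bigr => j _; have ji := ltn_ord j.
  rewrite !tcoef_qtrunc ?coefM; try lia.
  apply: eq_bigr => t' _; rewrite !coef_poly !ltnS.
  by do 2!case: leqP => _ //=; rewrite ?mulr0 ?mul0r.
(* Beyond t = 2i no t' satisfies both range conditions, so the sum is 0. *)
have [tsmall|tbig] := ltnP; last first.
  rewrite big1 // => j _; rewrite big1 // => t' _; have := ltn_ord j; have := ltn_ord t'.
  by case: ifP => //; lia.
apply: eq_bigr => j _; have ji := ltn_ord j.
(* The condition t' <= t guards against natural subtraction, which would make t - t' equal to 0. *)
pose h (t' : nat) : int :=
  if [&& t' <= t, t' <= 2 * j & t - t' <= 2 * (i - j)]%N
   then F j (t'%:Z - j%:Z) * G (i - j)%N ((t - t')%N%:Z - (i - j)%N%:Z) else 0.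
transitivity (\sum_(t' < (2 * j).+1) h t').
  apply: eq_bigr => t' _; have := ltn_ord t'; rewrite ltnS => t'j; rewrite /h t'j /=.
  case: ifP => c1; case: ifP => c2 //; try lia.
  by congr (F _ _ * G _ _); lia.
rewrite (@sum_ord_support h _ t.+1).
- by apply: eq_bigr => t' _; have := ltn_ord t'; rewrite ltnS /h => ->.
- by move=> k kj; rewrite /h; case: ifP => //; lia.
- by move=> k kj; rewrite /h; case: ifP => //; lia.
Qed.

Lemma zrowD F G i : zrow (sadd F G) i = zrow F i + zrow G i.
Proof. by apply/polyP => t; rewrite coefD !coef_poly; case: ifP; rewrite ?addr0. Qed.

Lemma zrowB F G i : zrow (ssub F G) i = zrow F i - zrow G i.
Proof. by apply/polyP => t; rewrite coefB !coef_poly; case: ifP; rewrite ?subr0. Qed.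

Lemma qtruncD F G : qtrunc n (sadd F G) = qtrunc n F + qtrunc n G.
Proof.
apply: tser_ext => i ilen; rewrite [in RHS]/tcoef poly_of_qpolyD coefD -!/(tcoef _ _).
by rewrite !tcoef_qtrunc // zrowD.
Qed.

Lemma qtruncB F G : qtrunc n (ssub F G) = qtrunc n F - qtrunc n G.
Proof.
apply/eqP; rewrite eq_sym subr_eq; apply/eqP; rewrite -qtruncD.
by apply: eq_qtrunc => i _; rewrite zrowD zrowB subrK.
Qed.

Lemma qtrunc0 : qtrunc n szero = 0.
Proof.
apply: (addrI (qtrunc n szero)); rewrite -qtruncD addr0.
by apply: eq_qtrunc => i _; rewrite zrowD; apply/polyP => t; rewrite coefD !coef_poly; case: ifP.
Qed.

Lemma qtrunc_smono c (e : int) t d : e = t%:Z - d%:Z -> (t <= 2 * d)%N ->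
  qtrunc n (smono c e d) = mono n t d *~ c.
Proof.
move=> -> td; apply: tser_ext => i ilen; rewrite tcoef_qtrunc //.
have -> : tcoef (mono n t d *~ c) i = tcoef (mono n t d) i *~ c.
  have N (x : tser n) k : tcoef (x *+ k) i = tcoef x i *+ k.
    rewrite /tcoef; elim: k => [|k IHk]; first by rewrite !mulr0n coef0.
    by rewrite !mulrSr poly_of_qpolyD coefD IHk.
  by case: c => k; rewrite -?pmulrn ?N // !NegzE !mulrNz -!pmulrn -N /tcoef coefN.
rewrite tcoef_mono //; apply/polyP => j; rewrite coef_poly /smono.
case: (eqVneq i d) => [->|_] /=; last by rewrite mul0rz coef0 if_same.
rewrite coefMrz coefXn (_ : (_ == _) = (j == t)); last by apply/eqP/eqP; lia.
case: eqP => [->|_]; last by rewrite mul0rz if_same.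
by rewrite ltnS td intz.
Qed.

Lemma monoM t d t' d' : mono n t d * mono n t' d' = mono n (t + t') (d + d').
Proof. by rewrite -in_qpolyM -scalerAl -scalerAr scalerA -!exprD. Qed.

Lemma mono1 : mono n 0 0 = 1.
Proof. by rewrite /mono !expr0 scale1r in_qpoly1. Qed.

Lemma monoX t d k : mono n t d ^+ k = mono n (t * k) (d * k).
Proof.
elim: k => [|k IHk]; first by rewrite !muln0 expr0 mono1.
by rewrite exprS IHk monoM !mulnS.
Qed.

Lemma mono_big t d : (n < d)%N -> mono n t d = 0.
Proof.
move=> nd; apply: tser_ext => i ilen.
by rewrite tcoef_mono // /tcoef coef0; case: eqP => // ?; lia.
Qed.

Lemma mono_nil t d : (0 < d)%N -> mono n t d ^+ n.+1 = 0.
Proof. by move=> d0; rewrite monoX mono_big // leq_pmull. Qed.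

Lemma qtrunc1 : qtrunc n sone = 1.
Proof. by rewrite (@qtrunc_smono 1 0 0 0) // mono1. Qed.

Lemma qtrunc_prod (f : nat -> ser) K :
  qtrunc n (sprodl f K) = \prod_(i < K) qtrunc n (f i).
Proof.
rewrite -(big_mkord xpredT (fun i => qtrunc n (f i))) /sprodl /index_iota subn0.
elim: (iota 0 K) => [|k s IHs] /=; first by rewrite big_nil qtrunc1.
by rewrite big_cons qtrunc_mul IHs.
Qed.

Lemma qtrunc_sum (f : nat -> ser) K :
  qtrunc n (ssuml f K) = \sum_(i < K) qtrunc n (f i).
Proof.
rewrite -(big_mkord xpredT (fun i => qtrunc n (f i))) /ssuml /index_iota subn0.
elim: (iota 0 K) => [|k s IHs] /=; first by rewrite big_nil qtrunc0.
by rewrite big_cons qtruncD IHs.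
Qed.

Lemma uniform_bound (P : nat -> nat -> Prop) (B : nat) :
  (forall b : nat, exists K, forall k, (K <= k)%N -> P b k) ->
  exists K, forall b : nat, (b < B)%N -> forall k, (K <= k)%N -> P b k.
Proof.
move=> H; elim: B => [|B [K IHK]]; first by exists 0%N.
have [K' HK'] := H B; exists (maxn K K') => b; rewrite ltnS leq_eqVlt => /predU1P[->|bB] k.
  by rewrite geq_max => /andP[_]; apply: HK'.
by rewrite geq_max => /andP[Kk _]; apply: IHK.
Qed.

(** A truncation has finitely many coefficients, so the separate bounds given by [sconv] merge into
    one, first within each row and then over the rows. *)
Lemma sconv_qtrunc (F : nat -> ser) G : sconv F G ->
  exists K, forall k, (K <= k)%N -> qtrunc n (F k) = qtrunc n G.
Proof.
move=> FG.
have ev (i : nat) : exists K, forall k, (K <= k)%N -> zrow (F k) i = zrow G i.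
  have [K HK] := @uniform_bound (fun t k => F k i (t%:Z - i%:Z) = G i (t%:Z - i%:Z))
    (2 * i).+1 (fun t => FG i (t%:Z - i%:Z)).
  exists K => k Kk; apply/polyP => t; rewrite !coef_poly.
  by case: ifP => // ti; apply: HK.
have [K HK] := uniform_bound n.+1 ev.
by exists K => k Kk; apply: eq_qtrunc => i ilen; apply: HK.
Qed.
End Truncation.

(** * Admissible series as limits of their truncations *)

Lemma qtrunc_inj (F G : ser) : admissible F -> admissible G ->
  (forall n, qtrunc n F = qtrunc n G) -> F = G.
Proof.
move=> aF aG H; apply: functional_extensionality => i.
apply: functional_extensionality => m.
have [mi|im] := leqP (absz m) i; last by rewrite aF ?aG.
by rewrite !zrow_coef // (qtrunc_zrow (H i)).
Qed.

(** The limit is read off diagonally: its coefficient of q^n is that of [F n.+1], where it has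
    reached its final value. *)
Lemma sconv_diag (F : nat -> ser) :
  (forall k, admissible (F k)) ->
  (forall n k, (n < k)%N -> qtrunc n (F k) = qtrunc n (F n.+1)) ->
  exists G, [/\ sconv F G, admissible G &
               forall n, qtrunc n G = qtrunc n (F n.+1)].
Proof.
move=> aF stab; exists (fun n m => F n.+1 n m); split.
- move=> i m; exists i.+1 => k ik.
  have [mi|im] := leqP (absz m) i; last by rewrite !aF.
  by rewrite !zrow_coef // (qtrunc_zrow (stab i k ik)).
- by move=> i m im; rewrite aF.
- move=> n; apply: eq_qtrunc => i ilen; rewrite -[LHS]/(zrow (F i.+1) i).
  by rewrite (qtrunc_zrow (stab i n.+1 _)).
Qed.

Lemma admissible_mono c e d : (absz e <= d)%N -> admissible (smono c e d).
Proof. by move=> ed n m nm; rewrite /smono; case: eqP => //= nd; case: eqP => // me; lia. Qed.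

(** The windows |j| <= i and |m - j| <= n - i force |m| <= n, whatever the factors are. *)
Lemma admissible_mul F G : admissible (smul F G).
Proof.
move=> n m nm; rewrite /smul big1 // => i _; rewrite big1 // => t _ /=.
by case: ifP => //; have := ltn_ord i; have := ltn_ord t; lia.
Qed.

Lemma admissible_prod f K : admissible (sprodl f K).
Proof.
rewrite /sprodl; case: (iota 0 K) => [|k s] /=; last exact: admissible_mul.
exact: admissible_mono.
Qed.

Lemma admissible_sum f K : (forall k, admissible (f k)) -> admissible (ssuml f K).
Proof.
move=> af; rewrite /ssuml; elim: (iota 0 K) => [|k s IHs] //= n m nm.
by rewrite /sadd af ?IHs ?addr0.
Qed.

(** * Truncation of the generating functions *)

(* The encodings of [z q^s] and [z^-1 q^s] are [mono n s.+1 s] and [mono n s.-1 s]. *)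
Definition summand n (s : nat) : tser n :=
  mono n s s *
    (\prod_(i < n.+1) ((1 + mono n 1 1 ^+ (s.+1 + i)) * (1 - mono n 1 1 ^+ (s.+1 + i))) *
     (\prod_(i < n.+1) geo n.+1 (mono n s.+1 s * mono n 1 1 ^+ i) *
      \prod_(i < n.+1) geo n.+1 (mono n s.-1 s * mono n 1 1 ^+ i))).

Lemma qtrunc_factor n c (e : int) (t d : nat) : e = t%:Z - d%:Z -> (t <= 2 * d)%N ->
  forall i, qtrunc n (ssub sone (smono c e (d + i))) =
            1 - (mono n t d * mono n 1 1 ^+ i) *~ c.
Proof.
move=> eE td i; rewrite qtruncB qtrunc1 (@qtrunc_smono _ _ _ (t + i)%N); try lia.
by rewrite monoX !mul1n monoM.
Qed.

Lemma qtrunc_poch_stable n c (e : int) (t d : nat) k :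
  e = t%:Z - d%:Z -> (t <= 2 * d)%N -> (n < k)%N ->
  qtrunc n (sprodl (fun k => ssub sone (smono c e (d + k))) k) =
  \prod_(i < n.+1) (1 - (mono n t d * mono n 1 1 ^+ i) *~ c).
Proof.
move=> eE td nk; rewrite qtrunc_prod.
under eq_bigr => i _ do rewrite (qtrunc_factor _ _ eE) //.
apply: (big_ord_stable (F := fun i => 1 - (mono n t d * mono n 1 1 ^+ i) *~ c)) => // i ni.
by rewrite (expr_ge0 (mono_nil n 1 _) ni) // mulr0 mul0rz subr0.
Qed.

Lemma qtrunc_poch n c (e : int) (t d : nat) P :
  e = t%:Z - d%:Z -> (t <= 2 * d)%N -> poch_inf c e d P ->
  qtrunc n P = \prod_(i < n.+1) (1 - (mono n t d * mono n 1 1 ^+ i) *~ c).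
Proof.
move=> eE td /(sconv_qtrunc n)[K HK].
by rewrite -(HK (maxn K n.+1)) ?leq_maxl // (qtrunc_poch_stable _ eE) // leq_maxr.
Qed.

Lemma poch_exists c (e : int) (t d : nat) : e = t%:Z - d%:Z -> (t <= 2 * d)%N ->
  exists P, poch_inf c e d P.
Proof.
move=> eE td; have [|n k nk|P [PP _ _]] := @sconv_diag
  (sprodl (fun k => ssub sone (smono c e (d + k)))).
- by move=> k; apply: admissible_prod.
- by rewrite !(qtrunc_poch_stable _ eE).
by exists P.
Qed.

Lemma qtrunc_poch_z n s P : (0 < s)%N -> poch_inf 1 1 s P ->
  qtrunc n P = \prod_(i < n.+1) (1 - mono n s.+1 s * mono n 1 1 ^+ i).
Proof.
by move=> s0 /(@qtrunc_poch n _ _ s.+1)->; try lia; apply: eq_bigr => i _; rewrite mulr1z.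
Qed.

Lemma qtrunc_poch_zV n s P : (0 < s)%N -> poch_inf 1 (-1) s P ->
  qtrunc n P = \prod_(i < n.+1) (1 - mono n s.-1 s * mono n 1 1 ^+ i).
Proof.
by move=> s0 /(@qtrunc_poch n _ _ s.-1)->; try lia; apply: eq_bigr => i _; rewrite mulr1z.
Qed.

Lemma geo_mono_prodK n t s : (0 < s)%N ->
  \prod_(i < n.+1) (1 - mono n t s * mono n 1 1 ^+ i) *
  \prod_(i < n.+1) geo n.+1 (mono n t s * mono n 1 1 ^+ i) = 1.
Proof.
move=> s0; apply: (geo_prodK (F := fun i => mono n t s * mono n 1 1 ^+ i)) => i.
exact/nilMl/mono_nil.
Qed.

(** [Inv] is known only through the equation it satisfies; since inverses are unique, its truncation
    is the product of the geometric sums. *)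
Lemma qtrunc_term n s Pm Pp Pz Pzi Inv : (0 < s)%N ->
  poch_inf (-1) 0 s.+1 Pm -> poch_inf 1 0 s.+1 Pp ->
  poch_inf 1 1 s Pz -> poch_inf 1 (-1) s Pzi ->
  smul (smul Pz Pzi) Inv = sone ->
  qtrunc n (smul (smono 1 0 s) (smul (smul Pm Pp) Inv)) = summand n s.
Proof.
move=> s0 hm hp hz hzi /(congr1 (qtrunc n)).
rewrite !qtrunc_mul qtrunc1 (qtrunc_poch_z n s0 hz) (qtrunc_poch_zV n s0 hzi).
have -> : qtrunc n Pm = \prod_(i < n.+1) (1 + mono n 1 1 ^+ (s.+1 + i)).
  rewrite (@qtrunc_poch n _ _ s.+1 _ _ _ _ hm) ?subrr //; last by lia.
  by apply: eq_bigr => i _; rewrite mulrN1z opprK exprD [in RHS]monoX !mul1n.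
have -> : qtrunc n Pp = \prod_(i < n.+1) (1 - mono n 1 1 ^+ (s.+1 + i)).
  rewrite (@qtrunc_poch n _ _ s.+1 _ _ _ _ hp) ?subrr //; last by lia.
  by apply: eq_bigr => i _; rewrite mulr1z exprD [in RHS]monoX !mul1n.
rewrite (@qtrunc_smono n 1 0 s s) ?subrr ?mulr1z; [|lia|lia].
move: (geo_mono_prodK n s.+1 s0) (geo_mono_prodK n s.-1 s0); rewrite /summand big_split /=.
move: (\prod_(i < n.+1) (1 - mono n s.+1 s * _)) (\prod_(i < n.+1) (1 - mono n s.-1 s * _)).
move: (\prod_(i < n.+1) geo _ _) (\prod_(i < n.+1) geo _ _) => y x x' y' xK yK invK.
congr (_ * (_ * _)).
transitivity ((x' * x) * (y' * y) * qtrunc n Inv); first by rewrite xK yK !mul1r.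
by transitivity (x * y * (x' * y' * qtrunc n Inv)); [ring | rewrite invK mulr1].
Qed.

Lemma summand_big n s : (n < s)%N -> summand n s = 0.
Proof. by move=> ns; rewrite /summand mono_big ?mul0r. Qed.

Lemma sum_summand_stable (ex : nat -> nat) n k : (forall j, (j < ex j)%N) -> (n <= k)%N ->
  \sum_(j < k) summand n (ex j) = \sum_(j < n) summand n (ex j).
Proof.
move=> exj nk; rewrite -!(big_mkord xpredT (fun j => summand n (ex j))).
rewrite (big_cat_nat (leq0n n) nk) /= [X in _ + X]big_nat_cond [X in _ + X]big1 ?addr0 // => j.
by rewrite andbT => /andP[nj _]; rewrite summand_big // (leq_ltn_trans nj).
Qed.

Lemma qtrunc_gen_series ex G n : (forall j, (j < ex j)%N) -> gen_series ex G ->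
  qtrunc n G = \sum_(j < n) summand n (ex j).
Proof.
move=> exj [Pm [Pp [Pz [Pzi [Inv [hm [hp [hz [hzi [hI /(sconv_qtrunc n)[K HK]]]]]]]]]]].
rewrite -(HK (maxn K n)) ?leq_maxl // qtrunc_sum.
rewrite -(@sum_summand_stable ex n (maxn K n)) ?leq_maxr //.
apply: eq_bigr => j _; have exj0 : (0 < ex j)%N by apply: leq_ltn_trans (exj j).
exact: (qtrunc_term n exj0 (hm j) (hp j) (hz j) (hzi j)).
Qed.

Lemma gen_series_admissible ex G : gen_series ex G -> admissible G.
Proof.
move=> [Pm [Pp [Pz [Pzi [Inv [_ [_ [_ [_ [_ hG]]]]]]]]]] n m nm.
have [K HK] := hG n m; rewrite -(HK K (leqnn K)).
by apply: admissible_sum nm => k; apply: admissible_mul.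
Qed.

(** * Existence of the generating series *)

Lemma geo_series_exists s t (e : int) : (0 < s)%N -> e = t%:Z - s%:Z -> (t <= 2 * s)%N ->
  exists G, forall n, qtrunc n G = \prod_(i < n.+1) geo n.+1 (mono n t s * mono n 1 1 ^+ i).
Proof.
move=> s0 eE ts.
(* The inner [sprodl] of a constant family is a power, so [F k] is a product of k geometric sums of
   k terms each. *)
pose F k := sprodl (fun i => ssuml (fun j => sprodl (fun _ => smono 1 e (s + i)) j) k) k.
have FE n k : (n < k)%N ->
    qtrunc n (F k) = \prod_(i < n.+1) geo n.+1 (mono n t s * mono n 1 1 ^+ i).
  move=> nk; rewrite qtrunc_prod.
  transitivity (\prod_(i < k) geo n.+1 (mono n t s * mono n 1 1 ^+ i)).
    apply: eq_bigr => i _; rewrite qtrunc_sum.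
    set x := mono n t s * _.
    have xN : x ^+ n.+1 = 0 by exact/nilMl/mono_nil.
    transitivity (\sum_(j < k) x ^+ j).
      apply: eq_bigr => j _; rewrite qtrunc_prod prodr_const card_ord.
      rewrite (@qtrunc_smono _ _ _ (t + i)%N); try lia.
      by rewrite mulr1z /x [mono n 1 1 ^+ i]monoX !mul1n monoM.
    rewrite /geo -!(big_mkord xpredT (fun j => x ^+ j)) (big_cat_nat (leq0n n.+1) nk) /=.
    rewrite [X in _ + X]big_nat_cond [X in _ + X]big1 ?addr0 // => j.
    by rewrite andbT => /andP[nj _]; apply: expr_ge0 xN nj.
  apply: (big_ord_stable (F := fun i => geo n.+1 (mono n t s * mono n 1 1 ^+ i))) => // i ni.
  by rewrite (expr_ge0 (mono_nil n 1 _) ni) // mulr0 geo0.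
have [|n k nk|G [_ _ GE]] := @sconv_diag F.
- by move=> k; apply: admissible_prod.
- by rewrite !FE.
by exists G => n; rewrite GE FE.
Qed.

Lemma gen_series_exists ex : (forall j, (j < ex j)%N) -> exists G, gen_series ex G.
Proof.
move=> exj; have ex0 j : (0 < ex j)%N by apply: leq_ltn_trans (exj j).
(* [gen_series] asks for whole families indexed by j, so one witness per j must be chosen. *)
have choose (T : nat -> ser -> Prop) : (forall j, exists P, T j P) ->
    exists P, forall j, T j (P j).
  move=> H; exists (fun j => proj1_sig (constructive_indefinite_description _ (H j))) => j.
  by case: constructive_indefinite_description.
have [Pm hm] : exists P, forall j, poch_inf (-1) 0 (ex j).+1 (P j).
  by apply: (choose (fun j => poch_inf (-1) 0 (ex j).+1)) => j;
    apply: (@poch_exists _ _ (ex j).+1); lia.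
have [Pp hp] : exists P, forall j, poch_inf 1 0 (ex j).+1 (P j).
  by apply: (choose (fun j => poch_inf 1 0 (ex j).+1)) => j;
    apply: (@poch_exists _ _ (ex j).+1); lia.
have [Pz hz] : exists P, forall j, poch_inf 1 1 (ex j) (P j).
  by apply: (choose (fun j => poch_inf 1 1 (ex j))) => j;
    apply: (@poch_exists _ _ (ex j).+1); have := ex0 j; lia.
have [Pzi hzi] : exists P, forall j, poch_inf 1 (-1) (ex j) (P j).
  by apply: (choose (fun j => poch_inf 1 (-1) (ex j))) => j;
    apply: (@poch_exists _ _ (ex j).-1); have := ex0 j; lia.
(* The inverse is the product of two limits of geometric products; the equation is checked in every
   truncation and lifted by [qtrunc_inj]. *)
have [Inv hI] : exists P, forall j, smul (smul (Pz j) (Pzi j)) (P j) = sone.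
  apply: (choose (fun j P => smul (smul (Pz j) (Pzi j)) P = sone)) => j; have s0 := ex0 j.
  have [|||G1 hG1] := @geo_series_exists (ex j) (ex j).+1 1; try lia.
  have [|||G2 hG2] := @geo_series_exists (ex j) (ex j).-1 (-1); try lia.
  exists (smul G1 G2); apply: qtrunc_inj => [||n].
  - exact: admissible_mul.
  - exact: admissible_mono.
  rewrite !qtrunc_mul qtrunc1 hG1 hG2 (qtrunc_poch_z n s0 (hz j)) (qtrunc_poch_zV n s0 (hzi j)).
  by rewrite mulrACA !geo_mono_prodK // mulr1.
pose F := ssuml (fun j => smul (smono 1 0 (ex j)) (smul (smul (Pm j) (Pp j)) (Inv j))).
have FE n k : qtrunc n (F k) = \sum_(j < k) summand n (ex j).
  rewrite qtrunc_sum; apply: eq_bigr => j _.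
  exact: (qtrunc_term n (ex0 j) (hm j) (hp j) (hz j) (hzi j)).
have [|n k nk|G [hG _ _]] := @sconv_diag F.
- by move=> k; apply: admissible_sum => j; apply: admissible_mul.
- rewrite !FE !(@sum_summand_stable ex n) //; exact: ltnW.
by exists G, Pm, Pp, Pz, Pzi, Inv.
Qed.

(** * Sums over multiplicity functions *)

(** A finite function stands for a multiset of numbers at most [n] with multiplicities at most [n],
    which suffices for partitions of weight at most [n]. *)
Definition supported n (A : pred nat) : pred {ffun 'I_n.+1 -> 'I_n.+1} :=
  [pred f | f \in family (fun i : 'I_n.+1 => [pred c : 'I_n.+1 | (c == 0 :> nat) || A i])].

Definition small_part (s : nat) : pred nat := fun j => (s <= j <= 2 * s - 1)%N.

Definition second_part (s : nat) : pred nat :=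
  fun j => (s <= j)%N && ((2 * s + 1 <= j)%N ==> odd j).

(** Expanding the product of geometric sums: a multiplicity function picks one power for each part,
    and only the power 0 outside [A]. *)
Lemma sum_supported (R : comNzRingType) n (x : nat -> R) (A : pred nat) :
  \sum_(f | supported A f) \prod_(i < n.+1) x i ^+ f i =
  \prod_(i < n.+1) (if A i then geo n.+1 (x i) else 1).
Proof.
rewrite -(bigA_distr_big_dep
  (fun i : 'I_n.+1 => [pred c : 'I_n.+1 | (c == 0 :> nat) || A i]) (fun i c => x i ^+ c)).
apply: eq_bigr => i _ /=.
case: ifP => Ai; first by rewrite /geo; apply: eq_bigl => c /=; rewrite orbT.
rewrite (big_pred1 ord0) ?expr0 // => c.
by rewrite orbF.
Qed.

Lemma prod_monoX n (f : {ffun 'I_n.+1 -> 'I_n.+1}) (t d : nat -> nat) :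
  \prod_(i < n.+1) mono n (t i) (d i) ^+ f i =
  mono n (\sum_(i < n.+1) t i * f i) (\sum_(i < n.+1) d i * f i).
Proof.
elim/big_ind3: _ => [|x a b y c d' -> ->|i _]; last exact: monoX.
  by rewrite mono1.
by rewrite monoM.
Qed.

(** * Weighted sums over pairs with a fixed smallest part *)

Section FixedSmallestPart.
Variables (n s : nat).
Hypothesis s_gt0 : (0 < s)%N.
Local Notation M := n.+1.
Local Notation q := (mono n 1 1).
Local Notation mult := {ffun 'I_M -> 'I_M}.

(** [mono n i.+1 i] encodes z q^i: each part at least s + k raises the crank by one. *)
Definition first_weight k i := if (s + k <= i)%N then mono n i.+1 i else mono n i i.

(** [mono n i.-1 i] encodes z^-1 q^i: the k small parts together supply the term - k of the
    crank. *)
Definition second_weight i := if small_part s i then mono n i.-1 i else mono n i i.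

Definition small_count (f : mult) := (\sum_(i < M | small_part s i) f i)%N.

Lemma qX i : q ^+ i = mono n i i.
Proof. by rewrite monoX !mul1n. Qed.

Lemma sum_first k :
  \sum_(f : mult | supported (leq s) f) \prod_(i < M) first_weight k i ^+ f i =
  \prod_(i < k) geo M (q ^+ (s + i)) *
  \prod_(i < M) geo M (mono n s.+1 s * q ^+ (k + i)).
Proof.
rewrite sum_supported.
pose F i := if (s <= i)%N then geo M (first_weight k i) else 1.
have F1 i : (M <= i)%N -> F i = 1.
  move=> Mi; rewrite /F /first_weight !mono_big //.
  by case: ifP; rewrite ?if_same ?geo0.
(* The three blocks are the indices below s, the k parts weighted without z, and [M] parts weighted
   with z; factors of index above [n] equal 1. *)
rewrite -(big_ord_stable F1 (leq_addl (s + k) M)) !big_split_ord /=.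
rewrite [X in X * _ * _]big1 ?mul1r => [|i _]; last first.
  by rewrite /F leqNgt ltn_ord.
congr (_ * _); apply: eq_bigr => i _; rewrite /F /first_weight.
  by rewrite leq_addr leqNgt ltn_add2l ltn_ord /= qX.
rewrite -addnA leq_addr addnA leq_addr qX monoM addSn.
by rewrite !addnA.
Qed.

Lemma geo_polyC (x : tser n) : geo M (x%:P) = (geo M x)%:P.
Proof. by rewrite /geo rmorph_sum; apply: eq_bigr => i _; rewrite rmorphXn. Qed.

(** The oddness condition starts only at 2s + 1, so the part 2s stays allowed next to the odd parts
    above it. *)
Lemma geo_parity_prod m :
  \prod_(i < (2 * m).+1)
     (if second_part s (2 * s + i) then geo M (q ^+ (2 * s + i)) else 1) =
  geo M (q ^+ (2 * s)) * \prod_(i < m) geo M (q ^+ (2 * s + (2 * i).+1)).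
Proof.
elim: m => [|m IHm].
  rewrite big_ord_recl !big_ord0 /second_part /= !addn0 mulr1.
  by rewrite ifT ?mulr1 //; lia.
rewrite mulnS 2!big_ord_recr /= IHm big_ord_recr /=.
have -> : second_part s (2 * s + (2 * m).+1) = true by rewrite /second_part; lia.
have -> : second_part s (2 * s + (2 * m).+2) = false by rewrite /second_part; lia.
by rewrite mulr1 mulrA.
Qed.

Lemma second_generating :
  \sum_(f : mult | supported (second_part s) f)
     (\prod_(i < M) second_weight i ^+ f i) *: 'X^(small_count f) =
  \prod_(i < s) geo M ((mono n s.-1 s * q ^+ i) *: 'X) *
  (geo M (q ^+ (2 * s)) * \prod_(i < M) geo M (q ^+ (2 * s + (2 * i).+1)))%:P.
Proof.
(* The polynomial variable counts the small parts. *)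
pose Y i : {poly tser n} := if small_part s i then second_weight i *: 'X else (second_weight i)%:P.
transitivity (\sum_(f : mult | supported (second_part s) f) \prod_(i < M) Y i ^+ f i).
  apply: eq_bigr => f _; rewrite /small_count.
  transitivity (\prod_(i < M) ((second_weight i ^+ f i)%:P *
     (if small_part s i then 'X^(f i) else 1 : {poly tser n}))).
    rewrite big_split /= -rmorph_prod -mul_polyC; congr (_ * _).
    by rewrite -big_mkcond /= expr_sum.
  apply: eq_bigr => i _; rewrite /Y; case: ifP => _.
    by rewrite exprZn mul_polyC.
  by rewrite mulr1 rmorphXn.
rewrite sum_supported.
pose F i := if second_part s i then geo M (Y i) else 1.
have F1 i : (M <= i)%N -> F i = 1.
  move=> Mi; have w0 : second_weight i = 0.
    by rewrite /second_weight !mono_big //; case: ifP.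
  have -> : F i = if second_part s i then geo M 0 else 1.
    by rewrite /F /Y w0 scale0r polyC0; case: (small_part s i).
  by rewrite geo0 //; case: ifP.
(* The blocks are the indices below s, the small parts s, ..., 2s - 1, and then 2s followed by [M]
   odd and [M] even indices. *)
have MM : (M <= s + (s + (2 * M).+1))%N by lia.
rewrite -(big_ord_stable F1 MM) !big_split_ord /=.
rewrite [X in X * _]big1 ?mul1r => [|i _]; last first.
  by rewrite /F /second_part leqNgt ltn_ord.
congr (_ * _).
  apply: eq_bigr => i _; have is_ := ltn_ord i; rewrite /F /Y /second_weight.
  have -> : second_part s (s + i) by rewrite /second_part; lia.
  have -> : small_part s (s + i) by rewrite /small_part; lia.
  by rewrite qX monoM -[(s.-1 + i)%N]/(s.-1 + i)%N; congr (geo _ (mono _ _ _ *: _)); lia.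
rewrite -geo_parity_prod rmorph_prod /=; apply: eq_bigr => i _.
rewrite /F /Y /second_weight addnA addnn -mul2n.
have -> : small_part s (2 * s + i) = false by rewrite /small_part; lia.
by rewrite qX; case: ifP => _; rewrite ?geo_polyC ?polyC1.
Qed.

(** A crude bound making the sum over k finite; it exceeds [M], as the q-binomial theorem
    requires. *)
Lemma small_count_lt f : (small_count f < (M * M).+1)%N.
Proof.
rewrite ltnS /small_count; apply: (@leq_trans (\sum_(i < M) M)%N).
  by rewrite big_mkcond; apply: leq_sum => i _; case: ifP => // _; apply/ltnW/ltn_ord.
by rewrite sum_nat_const card_ord.
Qed.

(** The first partition depends on the second only through k, so the sum is sorted by k by
    extracting the coefficient of 'X^k from [second_generating]. *)
Lemma sum_second (G : nat -> tser n) :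
  \sum_(f : mult | supported (second_part s) f)
     (\prod_(i < M) second_weight i ^+ f i) * G (small_count f) =
  (\sum_(k < (M * M).+1)
     (\prod_(i < s) geo M ((mono n s.-1 s * q ^+ i) *: 'X))`_k * G k) *
  (geo M (q ^+ (2 * s)) * \prod_(i < M) geo M (q ^+ (2 * s + (2 * i).+1))).
Proof.
have := second_generating; move: (\prod_(i < s) _) (geo M _ * _) => P D gen.
rewrite mulr_suml.
transitivity (\sum_(k < (M * M).+1) \sum_(f : mult | supported (second_part s) f)
   ((\prod_(i < M) second_weight i ^+ f i) *: 'X^(small_count f))`_k * G k).
  rewrite exchange_big /=; apply: eq_bigr => f _.
  rewrite [RHS](bigD1 (Ordinal (small_count_lt f))) //= coefZ coefXn eqxx mulr1.
  rewrite [X in _ = _ + X]big1 ?addr0 // => k /eqP kf; rewrite coefZ coefXn.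
  by case: eqP => [E|]; rewrite ?mulr0 ?mul0r //; case: kf; apply: val_inj.
apply: eq_bigr => k _; rewrite -mulr_suml -coef_sum gen coefMC.
by rewrite mulrAC.
Qed.

Lemma sum_fixed_smallest :
  \sum_(f2 : mult | supported (second_part s) f2) \sum_(f1 : mult | supported (leq s) f1)
     mono n s s * (\prod_(i < M) second_weight i ^+ f2 i *
                   \prod_(i < M) first_weight (small_count f2) i ^+ f1 i) =
  summand n s.
Proof.
under eq_bigr => f2 _ do rewrite -mulr_sumr -mulr_sumr sum_first.
rewrite -mulr_sumr (sum_second (fun k => \prod_(i < k) geo M (q ^+ (s + i)) *
  \prod_(i < M) geo M (mono n s.+1 s * q ^+ (k + i)))).
rewrite (summand_identity (mono_nil n 1 _) (mono_nil n s.+1 s_gt0) (mono_nil n s.-1 s_gt0)) //.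
- by rewrite monoM qX; congr (mono n _ _); lia.
- by lia.
Qed.

(** The term is z^(c - k) q^w in the shifted encoding. Small parts are positive, whence k <= w, and
    the natural subtraction is exact. *)
Lemma summand_term (f1 f2 : mult) :
  let k := small_count f2 in
  let w := (s + \sum_(i < M) i * f1 i + \sum_(i < M) i * f2 i)%N in
  let c := (\sum_(i < M | s + k <= i) f1 i)%N in
  (k <= w)%N /\
  mono n s s * (\prod_(i < M) second_weight i ^+ f2 i *
                \prod_(i < M) first_weight k i ^+ f1 i) = mono n (w + c - k) w.
Proof.
move=> k w c.
have E1 : (\sum_(i < M) (if s + k <= i then i.+1 else i) * f1 i =
           \sum_(i < M) i * f1 i + c)%N.
  have -> : c = (\sum_(i < M) (if s + k <= i then (f1 i : nat) else 0))%N by exact: big_mkcond.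
  rewrite -big_split; apply: eq_bigr => i _ /=.
  by case: ifP => _; rewrite ?addn0 // mulSn addnC.
have E2 : (\sum_(i < M) (if small_part s i then i.-1 else i) * f2 i + k =
           \sum_(i < M) i * f2 i)%N.
  have -> : k = (\sum_(i < M) (if small_part s i then (f2 i : nat) else 0))%N by exact: big_mkcond.
  rewrite -big_split; apply: eq_bigr => i _ /=.
  case: ifP => [si|_]; rewrite ?addn0 //.
  have i0 : (0 < i)%N by case/andP: si => + _; apply: leq_trans.
  by rewrite -{2}(prednK i0) mulSn addnC.
split; first by rewrite /w -E2; lia.
have -> : \prod_(i < M) second_weight i ^+ f2 i =
    \prod_(i < M) mono n (if small_part s i then i.-1 else i) i ^+ f2 i.
  by apply: eq_bigr => i _; rewrite /second_weight; case: ifP.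
have -> : \prod_(i < M) first_weight k i ^+ f1 i =
    \prod_(i < M) mono n (if (s + k <= i)%N then i.+1 else i) i ^+ f1 i.
  by apply: eq_bigr => i _; rewrite /first_weight; case: ifP.
rewrite (prod_monoX f2 (fun i => if small_part s i then i.-1 else i) id).
rewrite (prod_monoX f1 (fun i => if (s + k <= i)%N then i.+1 else i) id).
by rewrite !monoM /w E1 -E2; congr (mono n _ _); lia.
Qed.
End FixedSmallestPart.

(** * Pairs of partitions *)

Section Multiplicities.
Variable n : nat.
Local Notation M := n.+1.
Local Notation mult := {ffun 'I_M -> 'I_M}.
Implicit Types f : mult.

Definition mset f : seq nat :=
  sort geq (flatten [seq nseq (f i) (val i) | i <- enum 'I_M]).

Lemma count_mset p f : count p (mset f) = (\sum_(i < M | p i) f i)%N.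
Proof.
rewrite (permP (permEl (perm_sort _ _))) count_flatten -map_comp sumnE big_map.
rewrite big_enum /= [RHS]big_mkcond; apply: eq_bigr => i _.
by rewrite count_nseq; case: (p i); rewrite ?mul1n ?mul0n.
Qed.

Lemma sumn_mset f : sumn (mset f) = (\sum_(i < M) i * f i)%N.
Proof.
rewrite (perm_sumn (permEl (perm_sort _ _))) sumn_flatten -map_comp sumnE big_map.
by rewrite big_enum /=; apply: eq_bigr => i _; rewrite sumn_nseq.
Qed.

Lemma geq_total : total geq.
Proof. by move=> x y; apply: leq_total. Qed.

Lemma geq_trans : transitive geq.
Proof. by move=> x y z /= xy yz; apply: leq_trans yz xy. Qed.

Lemma geq_anti : antisymmetric geq.
Proof. by move=> x y /= xy; apply: anti_leq; rewrite andbC. Qed.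

Lemma sorted_mset f : sorted geq (mset f).
Proof. exact: sort_sorted geq_total _. Qed.

Lemma count_mem_mset f (i : 'I_M) : count_mem (val i) (mset f) = f i.
Proof.
by rewrite count_mset (big_pred1 i) // => j /=; rewrite -val_eqE.
Qed.

Lemma mset_inj : injective mset.
Proof.
by move=> f g fg; apply/ffunP => i; apply: val_inj; rewrite /= -!count_mem_mset fg.
Qed.

(** The two bounds make the multiplicities and the parts fit into ['I_M]. *)
Lemma mset_surj (l : seq nat) : sorted geq l -> (size l <= n)%N -> all (leq^~ n) l ->
  exists f, mset f = l.
Proof.
move=> sl sz al; have cn (i : nat) : (count_mem i l < M)%N.
  by rewrite ltnS (leq_trans (count_size _ _)).
pose f : mult := [ffun i : 'I_M => Ordinal (cn i)].
exists f; apply: (sorted_eq geq_trans geq_anti (sorted_mset f) sl).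
apply/allP => x _ /=; apply/eqP.
have [xn|nx] := leqP x n.
  have -> : x = val (Ordinal (xn : (x < M)%N)) by [].
  by rewrite count_mem_mset ffunE.
rewrite count_mset big1 => [|i /eqP ix]; last by have := ltn_ord i; lia.
by apply/esym/count_memPn/negP => /(allP al) /=; lia.
Qed.

Lemma all_mset (A : pred nat) f : all A (mset f) = supported A f.
Proof.
apply/idP/idP => H.
  apply/familyP => i; rewrite !inE; case: (boolP (A i)); rewrite ?orbT // => nA.
  rewrite orbF -[nat_of_ord (f i)]count_mem_mset; apply/eqP/count_memPn.
  by apply: contra nA => /(allP H).
rewrite all_count -(count_predC A) -[X in X == _]addn0 eqn_add2l eq_sym.
rewrite count_mset big1 // => i /= nA.
by have /familyP /(_ i) := H; rewrite !inE (negPf nA) orbF => /eqP.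
Qed.
End Multiplicities.

Lemma spart_rcons l s : all (leq s) l -> spart (rcons l s) = s.
Proof.
move=> al; rewrite /spart; have : (s <= head 0 (rcons l s))%N by case: l al => //= x l /andP[].
move: (head _ _) => h hs.
elim: l al => [_|x l IHl /= /andP[sx /IHl->]] /=; first exact/minn_idPl.
exact/minn_idPr.
Qed.

Lemma is_partition_rcons l s : (0 < s)%N ->
  is_partition (rcons l s) = is_partition l && all (leq s) l.
Proof.
move=> s0; rewrite /is_partition all_rcons s0 /=.
rewrite -[sorted _ (rcons l s)]rev_sorted -[sorted _ l]rev_sorted rev_rcons /=.
rewrite path_sortedE; last by move=> x y z /=; apply: leq_trans.
by rewrite all_rev; case: (all (leq s) l) (sorted _ _) => [] [] //=; rewrite ?andbT ?andbF.
Qed.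

Lemma size_sumn (l : seq nat) : all (leq 1) l ->
  (size l <= sumn l)%N /\ all (leq^~ (sumn l)) l.
Proof.
elim: l => //= x l IHl /andP[x0 /IHl[sl al]]; split; first by lia.
rewrite leq_addr /=; apply: sub_all al => y /= yl; lia.
Qed.

Section Pairs.
Variables (n : nat) (cls : pred nat).
Local Notation M := n.+1.
Local Notation mult := {ffun 'I_M -> 'I_M}.
Local Notation code := ('I_M * mult * mult)%type.
Implicit Types x : code.

(* [((s, f2), f1)] encodes the pair whose first partition is [s] together with
   the multiset [f1], and whose second one is [f2].  Splitting off one copy of
   the smallest part makes both cases of the crank equal to
   #(parts >= s + k in [f1]) - k. *)
Definition pair_of x : seq nat * seq nat := (rcons (mset x.2) x.1.1, mset x.1.2).

Definition valid x :=
  [&& (0 < x.1.1)%N && cls x.1.1, supported (second_part x.1.1) x.1.2 &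
      supported (leq x.1.1) x.2].

Lemma pair_of_inj : injective pair_of.
Proof. by move=> [[s f2] f1] [[s' f2'] f1'] [] /rcons_inj[] /mset_inj-> /val_inj-> /mset_inj->. Qed.

Lemma spart_pair x : valid x -> spart (pair_of x).1 = x.1.1.
Proof. by case/and3P => _ _ s1; apply: spart_rcons; rewrite all_mset. Qed.

Lemma in_SPbar_rcons l1 l2 s : (0 < s)%N -> all (leq s) l1 ->
  in_SPbar (rcons l1 s, l2) =
  [&& sorted geq l1, sorted geq l2 & all (second_part s) l2].
Proof.
move=> s0 al1; rewrite /in_SPbar spart_rcons // is_partition_rcons // /is_partition al1.
have -> : all (leq 1) l1 by apply: sub_all al1 => j; apply: leq_trans.
have -> : rcons l1 s != [::] by case: l1 {al1}.
have -> : all (second_part s) l2 =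
    all (fun j => s <= j)%N l2 && all (fun j => (2 * s + 1 <= j)%N ==> odd j) l2.
  by rewrite -all_predI.
have [al2|] := boolP (all (fun j => s <= j)%N l2); rewrite !andbT ?andbF ?andFb //=.
have -> : all (leq 1) l2 by apply: sub_all al2 => j; apply: leq_trans.
by rewrite andbT.
Qed.

Lemma in_SPbar_pair x : valid x -> in_SPbar (pair_of x).
Proof.
case/and3P => /andP[s0 _] s2 s1.
by rewrite in_SPbar_rcons ?all_mset // !sorted_mset.
Qed.

Lemma SPweight_pair x :
  SPweight (pair_of x) = (x.1.1 + \sum_(i < M) i * x.2 i + \sum_(i < M) i * x.1.2 i)%N.
Proof.
rewrite /SPweight /= -cats1 sumn_cat !sumn_mset /= addn0.
by rewrite (addnC (\sum_(i < M) _)%N (x.1.1 : nat)).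
Qed.

Lemma kSP_pair x : valid x -> kSP (pair_of x) = small_count x.1.1 x.1.2.
Proof. by move=> vx; rewrite /kSP spart_pair // count_mset. Qed.

Lemma crank_pair x : valid x -> let k := small_count x.1.1 x.1.2 in
  crank_bar (pair_of x) = (\sum_(i < M | x.1.1 + k <= i) x.2 i)%N%:Z - k%:Z.
Proof.
move=> vx k; rewrite /crank_bar spart_pair // kSP_pair // -/k -count_mset.
case: posnP => [->|k0] /=.
  (* For k = 0, the - 1 of the crank removes the split-off copy of s, and every remaining part is at
     least s. *)
  rewrite size_rcons addn0 subr0 -addn1 PoszD addrK; congr Posz.
  by apply/esym/eqP; rewrite -all_count all_mset; case/and3P: vx.
(* For k > 0, the split-off copy of s lies below s + k and is not counted. *)
rewrite -cats1 count_cat /= (_ : (_ <= _)%N = false) ?addn0 //; lia.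
Qed.

Lemma valid_surj p : in_SPbar p -> cls (spart p.1) -> SPweight p = n ->
  exists2 x, valid x & pair_of x = p.
Proof.
case: p => l1 l2; case/lastP: l1 => [|l1 s]; first by rewrite /in_SPbar /= !andbF.
move=> Sp; have : is_partition (rcons l1 s) by case/and5P: Sp.
rewrite {1}/is_partition all_rcons => /andP[_ /andP[s0 _]].
have al1 : all (leq s) l1.
  by case/and5P: Sp; rewrite is_partition_rcons // => /andP[].
rewrite spart_rcons //= => cs; rewrite /SPweight /= -cats1 sumn_cat /= addn0 => wn.
move: Sp; rewrite in_SPbar_rcons // => /and3P[so1 so2 al2].
(* Parts are positive, so the weight [n] bounds both their number and their size. *)
have [|sz1 le1] := @size_sumn l1; first by apply: sub_all al1 => j; apply: leq_trans.
have [|sz2 le2] := @size_sumn l2.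
  by apply: sub_all al2 => j /andP[+ _]; apply: leq_trans.
have [||f1 E1] := @mset_surj n l1 so1; first by lia.
  by apply: sub_all le1 => j /=; lia.
have [||f2 E2] := @mset_surj n l2 so2; first by lia.
  by apply: sub_all le2 => j /=; lia.
have sM : (s < M)%N by lia.
exists (Ordinal sM, f2, f1); last by rewrite /pair_of /= E1 E2 cats1.
by rewrite /valid /= s0 cs -!all_mset E1 E2 al1 al2.
Qed.

(** Crank plus weight is nonnegative by [summand_term], so [absz] loses nothing. Codes of weight
    above [n] contribute 0. *)
Lemma sum_valid :
  \sum_(x | valid x) mono n (absz (crank_bar (pair_of x) + (SPweight (pair_of x))%:Z))
                           (SPweight (pair_of x)) =
  \sum_(s < M | (0 < s)%N && cls s) summand n s.
Proof.
transitivity (\sum_(s < M | (0 < s)%N && cls s)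
  \sum_(f2 : mult | supported (second_part s) f2) \sum_(f1 : mult | supported (leq s) f1)
     mono n s s * (\prod_(i < M) second_weight n s i ^+ f2 i *
                   \prod_(i < M) first_weight n s (small_count s f2) i ^+ f1 i)).
  rewrite pair_big_dep pair_big_dep; apply: eq_big => [x|x]; first by rewrite /valid andbA.
  move=> vx; have s0 : (0 < x.1.1)%N by case/and3P: vx => /andP[].
  have [kw ->] := summand_term s0 x.2 x.1.2.
  rewrite crank_pair // SPweight_pair; congr (mono n _ _).
  by move: kw => /=; lia.
by apply: eq_bigr => s /andP[s0 _]; apply: sum_fixed_smallest.
Qed.

(** The combinatorial counterpart of admissibility: c - k lies between - w and w, since k <= w and
    each of the c counted parts is positive. *)
Lemma crank_bound x : valid x -> (absz (crank_bar (pair_of x)) <= SPweight (pair_of x))%N.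
Proof.
move=> vx; have s0 : (0 < x.1.1)%N by case/and3P: vx => /andP[].
have [kw _] := summand_term s0 x.2 x.1.2.
rewrite crank_pair // SPweight_pair; move: kw.
set k := small_count _ _; set c := (\sum_(i < M | x.1.1 + k <= i) _)%N.
have : (c <= \sum_(i < M) i * x.2 i)%N.
  have -> : c = (\sum_(i < M) (if x.1.1 + k <= i then (x.2 i : nat) else 0))%N by exact: big_mkcond.
  apply: leq_sum => i _; case: ifP => // ki.
  by rewrite leq_pmull // (leq_trans _ ki) // ltn_addr.
by lia.
Qed.

Definition pair_list (m : int) : seq (seq nat * seq nat) :=
  [seq p <- map pair_of (enum (valid : pred code)) | (SPweight p == n) && (crank_bar p == m)].

Lemma pair_list_uniq m : uniq (pair_list m).
Proof. by rewrite filter_uniq // map_inj_uniq ?enum_uniq //; apply: pair_of_inj. Qed.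

Lemma mem_pair_list m p : p \in pair_list m <->
  [/\ in_SPbar p, cls (spart p.1), SPweight p = n & crank_bar p = m].
Proof.
rewrite mem_filter; split.
  case/andP => /andP[/eqP wp /eqP cp] /mapP[x]; rewrite mem_enum => vx pE.
  split=> //; rewrite pE; first exact: in_SPbar_pair.
  by rewrite spart_pair //; case/and3P: vx => /andP[].
case=> ip cp wp mp; rewrite wp mp !eqxx /=.
by have [x vx <-] := valid_surj ip cp wp; apply: map_f; rewrite mem_enum.
Qed.

Lemma size_pair_list m : size (pair_list m) =
  (\sum_(x | valid x) ((SPweight (pair_of x) == n) && (crank_bar (pair_of x) == m)))%N.
Proof.
by rewrite size_filter count_map -sumn_count sumnE big_map big_enum.
Qed.

Lemma coefficient_pair_list G m : admissible G ->
  qtrunc n G = \sum_(s < M | (0 < s)%N && cls s) summand n s ->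
  G n m = (size (pair_list m))%:Z.
Proof.
move=> aG; rewrite -sum_valid size_pair_list => GE.
(* For |m| > n both sides vanish: [G] by admissibility, the count by [crank_bound]. *)
have [mn|nm] := leqP (absz m) n; last first.
  rewrite aG // big1 // => x vx; apply/eqP; rewrite eqb0; apply/negP => /andP[/eqP wx /eqP cx].
  by have := crank_bound vx; rewrite wx cx leqNgt nm.
rewrite zrow_coef // -(tcoef_qtrunc _ (leqnn n)) GE tcoef_sum coef_sum.
rewrite -[RHS]natz natr_sum; apply: eq_bigr => x vx.
rewrite tcoef_mono // eq_sym; case: eqP => [wx|_] /=; last by rewrite coef0.
rewrite coefXn wx; congr ((nat_of_bool _)%:R).
(* Both cranks are at least - n, so equality of the shifted natural exponents is equality of the
   cranks. *)
by have := crank_bound vx; rewrite wx => cb; apply/eqP/eqP; lia.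
Qed.
End Pairs.

(** * Coefficients as counts, for all, odd and even smallest parts *)

Lemma counts_iff (P Q : seq nat * seq nat -> Prop) N :
  (forall p, P p <-> Q p) -> counts P N -> counts Q N.
Proof. by move=> PQ [L [uL [memL sL]]]; exists L; do 2!split=> //; move=> p; rewrite memL. Qed.

Lemma gen_series_counts ex (cls : pred nat) n (m : int) G : (forall j, (j < ex j)%N) ->
  \sum_(j < n) summand n (ex j) = \sum_(s < n.+1 | (0 < s)%N && cls s) summand n s ->
  gen_series ex G -> exists N : nat, G n m = N%:Z /\
    counts (fun p => [/\ in_SPbar p, cls (spart p.1), SPweight p = n & crank_bar p = m]) N.
Proof.
move=> exj exE hG; exists (size (pair_list n cls m)); split.
  apply: coefficient_pair_list; first exact: gen_series_admissible hG.
  by rewrite (qtrunc_gen_series n exj hG).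
by exists (pair_list n cls m); split; [apply: pair_list_uniq | split=> // p; apply: mem_pair_list].
Qed.

Lemma sum_summand_range n k (P : pred nat) : (n < k)%N ->
  \sum_(s < n.+1 | P s) summand n s = \sum_(s < k | P s) summand n s.
Proof.
move=> nk; rewrite -!(big_mkord P (summand n)) [RHS](big_cat_nat (leq0n n.+1) nk) /=.
rewrite [X in _ = _ + X]big_nat_cond [X in _ = _ + X]big1 ?addr0 // => s.
by case/andP => /andP[ns _] _; apply: summand_big.
Qed.

Lemma sum_odd (V : nmodType) (f : nat -> V) k :
  \sum_(j < k) f (2 * j).+1 = \sum_(s < (2 * k).+1 | (0 < s)%N && odd s) f s.
Proof.
rewrite [RHS]big_mkcond /=; elim: k => [|k IHk]; first by rewrite big_ord0 muln0 big_ord1.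
rewrite big_ord_recr /= IHk mulnS [RHS]big_ord_recr [X in _ = X + _]big_ord_recr /=.
by rewrite mul2n /= odd_double addr0.
Qed.

Lemma sum_even (V : nmodType) (f : nat -> V) k :
  \sum_(j < k) f (2 * j).+2 = \sum_(s < (2 * k).+1 | (0 < s)%N && ~~ odd s) f s.
Proof.
rewrite [RHS]big_mkcond /=; elim: k => [|k IHk]; first by rewrite big_ord0 muln0 big_ord1.
rewrite big_ord_recr /= IHk mulnS [RHS]big_ord_recr [X in _ = X + _]big_ord_recr /=.
by rewrite mul2n /= odd_double addr0.
Qed.

Theorem theorem3p1 :
  (exists G, gen_series ex_S G) /\ (exists G, gen_series ex_S1 G) /\
  (exists G, gen_series ex_S2 G) /\
  forall (m : int) (n : nat), (1 <= n)%N ->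
    (forall G, gen_series ex_S G -> exists N : nat,
       G n m = N%:Z /\
       counts (fun p => [/\ in_SPbar p, SPweight p = n & crank_bar p = m]) N) /\
    (forall G, gen_series ex_S1 G -> exists N : nat,
       G n m = N%:Z /\
       counts (fun p => [/\ in_SPbar p, odd (spart p.1),
                            SPweight p = n & crank_bar p = m]) N) /\
    (forall G, gen_series ex_S2 G -> exists N : nat,
       G n m = N%:Z /\
       counts (fun p => [/\ in_SPbar p, ~~ odd (spart p.1),
                            SPweight p = n & crank_bar p = m]) N).
Proof.
have lt0 j : (j < ex_S j)%N by rewrite /ex_S.
have lt1 j : (j < ex_S1 j)%N by rewrite /ex_S1; lia.
have lt2 j : (j < ex_S2 j)%N by rewrite /ex_S2; lia.
split; first exact: gen_series_exists.
split; first exact: gen_series_exists.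
split; first exact: gen_series_exists.
move=> m n _; split=> [G hG|].
  have [|N [GE cN]] := @gen_series_counts _ xpredT n m G lt0 _ hG.
    (* The index s = 0 is excluded, and [ex_S j] = j + 1 runs through the others. *)
    rewrite [RHS]big_mkcond big_ord_recl /= add0r.
    by apply: eq_bigr.
  exists N; split=> //; apply: counts_iff cN => p.
  by split=> [[]|[]].
split=> G hG.
  apply: (gen_series_counts (cls := odd) _ lt1 _ hG).
  (* The values [ex_S1 j] with j < n reach 2n - 1; enlarging the range of s to 2n only adds summands
     with s > n, which vanish. *)
  rewrite (@sum_summand_range _ (2 * n).+1 (fun s => (0 < s)%N && odd s)); last by lia.
  exact: (sum_odd (summand n)).
apply: (gen_series_counts (cls := fun s => ~~ odd s) _ lt2 _ hG).
rewrite (@sum_summand_range _ (2 * n).+1 (fun s => (0 < s)%N && ~~ odd s)); last by lia.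
exact: (sum_even (summand n)).
Qed.
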